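(* Let $M$ and $N$ be subspaces of $\mathbb{C}^n$, and let $P$ and $Q$ be the orthogonal projections onto $M$ and $N$, respectively. If $M\cap N\neq\{0\}$, then $W(PQ)$ is the convex hull of the union of $[0,1]$ and all the sets $W(PQ|_{J_k})$. In other words, $$W(PQ)=\operatorname{Conv}\Big([0,1]\cup\bigcup_{k} W(PQ|_{J_k})\Big),$$ where the union runs over all indices $k$ for which the $k$-th Jordan plane $J_k$ associated with $M$ and $N$ is defined, i.e. those $k$ whose principal angle satisfies $0<\theta_k<\frac{\pi}{2}$.
   Context: Principal angles and vectors: for subspaces $M,N$ of $\mathbb{C}^n$ with $\dim M=p\ge q=\dim N$ (interchange roles otherwise), the principal angles $\theta_1,\dots,\theta_q\in[0,\pi/2]$ are defined recursively, with $M_0=N_0=\{0\}$, by $\cos\theta_i=\sup\{|\langle u,v\rangle|: u\in M\cap M_{i-1}^{\perp},\ v\in N\cap N_{i-1}^{\perp},\ \|u\|=\|v\|=1\}=\langle u_i,v_i\rangle$ for some chosen unit vectors $u_i\in M\cap M_{i-1}^{\perp}$, $v_i\in N\cap N_{i-1}^{\perp}$, where $M_{i}=\operatorname{span}\{u_1,\dots,u_{i}\}$ and $N_{i}=\operatorname{span}\{v_1,\dots,v_{i}\}$. The $u_i,v_i$ are called principal vectors. If $0<\theta_k<\pi/2$, the $k$-th Jordan plane associated with $M$ and $N$ is $J_k=\operatorname{span}\{u_k,v_k\}$. Each $J_k$ is invariant under $P$ and $Q$, so $PQ|_{J_k}$ is an operator on $J_k$. The numerical range of an operator $A$ on a finite-dimensional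 complex inner product space $H$ is $W(A)=\{\langle Ax,x\rangle: x\in H,\ \|x\|=1\}$. $\operatorname{Conv}(E)$ denotes the convex hull of $E\subset\mathbb{C}$; $[0,1]$ is the real interval regarded as a subset of $\mathbb{C}$.
   Formalization: The formal theorem excludes the case M = N = C^n, where the claim fails: there PQ = I, so W(PQ) = {1}, no Jordan plane is defined, and the convex hull is [0,1]. *)

(* Defs.v *)
From HB Require Import structures.
From mathcomp Require Import all_boot all_order all_algebra.
From mathcomp Require Import sesquilinear spectral.
From mathcomp Require Import all_classical all_reals all_analysis.
From mathcomp Require Import complex.

Set Implicit Arguments.
Unset Strict Implicit.
Unset Printing Implicit Defensive.

Import Order.TTheory GRing.Theory Num.Theory.

Local Open Scope classical_set_scope.
Local Open Scope ring_scope.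
Local Open Scope complex_scope.

(* C^n is 'rV[R[i]]_n; [dotmx x y] = \sum_k x_k * conj y_k. A subspace of C^n is
   the row space of a matrix (scope %MS). Operators are linear functions on
   'rV[R[i]]_n, so that [P \o Q] is x |-> P (Q x). *)

Section Definitions.
Context {R : realType} {n : nat}.
Local Notation C := R[i].
Local Notation V := 'rV[C]_n.

Definition vnorm (x : V) : C := sqrtC (dotmx x x).

Definition orthocomp (A : 'M[C]_n) : 'M[C]_n := orthomx Num.conj 1%:M A.

(* [proj_ortho M] acts on row vectors by right multiplication. *)
Definition orthoproj (M : 'M[C]_n) : V -> V := mulmxr (proj_ortho M).

HB.instance Definition _ (M : 'M[C]_n) :=
  GRing.Linear.copy (orthoproj M) (mulmxr (proj_ortho M)).

(* Numerical range of the restriction of A to the subspace H. When A maps H to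
   itself this is W(A|_H), H carrying the inner product inherited from C^n; with
   H = 1%:M, the whole space, it is W(A). *)
Definition num_range (A : {linear V -> V}) (H : 'M[C]_n) : set C :=
  [set dotmx (A x) x | x in [set x : V | (x <= H)%MS /\ vnorm x = 1]].

Section PrincipalVectors.
Variables M N : 'M[C]_n.

Definition nb_angles : nat := minn (\rank M) (\rank N).

Section Family.
Variable w : 'I_nb_angles -> V.

Definition span_before (i : 'I_nb_angles) : 'M[C]_n :=
  (\sum_(j < nb_angles | (j < i)%N) <<w j>>)%MS.

Definition rest (A : 'M[C]_n) (i : 'I_nb_angles) : 'M[C]_n :=
  (A :&: orthocomp (span_before i))%MS.

End Family.

(* Indices start at 0, so [span_before w i] is the span of the first i vectors.
   The conditions are symmetric under exchanging (M, u) and (N, v): the number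
   dotmx (u i) (v i) is real. Hence the cases \rank M >= \rank N and
   \rank M < \rank N are both covered. *)
Record principal_system (theta : 'I_nb_angles -> R)
    (u v : 'I_nb_angles -> V) : Prop := PrincipalSystem {
  principal_angle_itv : forall i, 0 <= theta i <= pi / 2 ;
  principal_vectl : forall i, (u i <= rest u M i)%MS /\ vnorm (u i) = 1 ;
  principal_vectr : forall i, (v i <= rest v N i)%MS /\ vnorm (v i) = 1 ;
  principal_cos_sup : forall i,
    cos (theta i) = sup [set r : R | exists x y : V,
      [/\ (x <= rest u M i)%MS, (y <= rest v N i)%MS,
          vnorm x = 1, vnorm y = 1 & r%:C = `|dotmx x y| ] ] ;
  principal_cos_dot : forall i, (cos (theta i))%:C = dotmx (u i) (v i) }.

(* Only meaningful when 0 < theta k < pi / 2. *)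
Definition jordan_plane (u v : 'I_nb_angles -> V) (k : 'I_nb_angles) :
    'M[C]_n :=
  (<<u k>> + <<v k>>)%MS.

End PrincipalVectors.

End Definitions.

Section ConvexHull.
Context {R : realType}.

(* [Rcomplex R] is R[i] as a vector space over R. *)
Definition conv_hull (E : set R[i]) : set R[i] :=
  smallest (@convex_set R (Rcomplex R)) E.

Definition unit_segment : set R[i] :=
  [set t%:C | t in [set t : R | 0 <= t <= 1]].

End ConvexHull.

(* Main.v *)
Require Import Defs.
From mathcomp Require Import all_boot all_order all_algebra.
From mathcomp Require Import sesquilinear spectral.
From mathcomp Require Import all_classical all_reals all_analysis.
From mathcomp Require Import complex.
From mathcomp Require Import ring lra.

(** Write [c_i] for the cosine of the i-th principal angle and [P], [Q] for the
    orthogonal projections onto [M], [N].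

    The principal vectors are biorthogonal.  Among unit vectors [x] of the i-th
    remaining part of [M], the number [|<x, v_i>|] is maximal at [u_i], so the
    projection of [v_i] onto that part is [c_i u_i] ([extremal_pair]).  Hence
    [<u_i, v_j> = 0] for [i <> j], and then [P v_i = c_i u_i] and
    [Q u_i = c_i v_i] on all of [M] and [N] ([principal_dot_v],
    [principal_dot_u]).  As the number of angles is the smaller of the two
    dimensions, the [u_i] span [M] or the [v_i] span [N], and so
    [<PQx, x> = \sum_i c_i <x, v_i> conj <x, u_i>] ([dot_projs]).

    The planes [J_i] spanned by [u_i] and [v_i], for every index [i], are pairwise
    orthogonal, and the i-th term above depends only on the projection [x_i] of
    [x] onto [J_i]: it is [<PQ x_i, x_i>] ([dot_projs_sum]).  That term is
    [|x_i|^2] times an element of [W(PQ|J_i)] when the angle is strictly between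
    [0] and [pi/2]; it lies between [0] and [|x_i|^2] when the angle is [0], and it
    vanishes when the angle is [pi/2].  By Bessel's inequality the weights
    [|x_i|^2] add up to at most [1], and [0] takes the remaining weight.  So
    [W(PQ)] lies in the convex hull.

    Conversely [W(PQ)] is convex ([toeplitz_hausdorff]) and contains each
    [W(PQ|J_k)].  It contains [1], the value at a unit vector of [M :&: N], and
    [0], the value at a unit vector orthogonal to one of [M], [N]
    that is a proper subspace. *)

Set Implicit Arguments.
Unset Strict Implicit.
Unset Printing Implicit Defensive.

Import Order.TTheory GRing.Theory Num.Theory.

Local Open Scope classical_set_scope.
Local Open Scope ring_scope.
Local Open Scope complex_scope.

(** * Inner products and orthogonal projections *)

Local Notation "''[' u , v ]" := (dotmx u v) : ring_scope.
Local Notation "''[' u ]" := (dotmx u u) : ring_scope.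

Section InnerProduct.
Context {C : numClosedFieldType} {n : nat}.
Implicit Types x y z u v : 'rV[C]_n.

Lemma dotC x y : '[x, y] = Num.conj '[y, x].
Proof. by rewrite hermC expr0 mul1r. Qed.

Lemma dotZl a x y : '[a *: x, y] = a * '[x, y].
Proof. exact: linearZl_LR. Qed.

Lemma dotZr a x y : '[x, a *: y] = Num.conj a * '[x, y].
Proof. exact: linearZr_LR. Qed.

Lemma dot0l x : '[0, x] = 0.
Proof. exact: linear0l. Qed.

Lemma dot0r x : '[x, 0] = 0.
Proof. exact: linear0r. Qed.

Lemma sqnormZ a x : '[a *: x] = `|a| ^+ 2 * '[x].
Proof. exact: dnormZ. Qed.

Lemma sqnormB x y : '[x - y] = '[x] + '[y] - ('[x, y] + Num.conj '[x, y]).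
Proof. exact: dnormB. Qed.

Lemma sqnorm_ge0 x : 0 <= '[x].
Proof. exact: dnorm_ge0. Qed.

Lemma sqnorm_eq0 x : ('[x] == 0) = (x == 0).
Proof. exact: dnorm_eq0. Qed.

Lemma sqnorm_gt0 x : (0 < '[x]) = (x != 0).
Proof. exact: dnorm_gt0. Qed.

Lemma sub_dot_orthoP m (A : 'M[C]_(m, n)) x :
  reflect (forall y, (y <= A)%MS -> '[x, y] = 0)
          (x <= orthomx Num.conj 1%:M A)%MS.
Proof.
apply: (iffP (orthomxP (hermitian1mx _) _ _)) => H.
  by move=> y yA; apply/(hermmx_eq0P (hermitian1mx _))/H.
move=> x' y /sub_rVP[a ->] yA; apply/(hermmx_eq0P (hermitian1mx _)).
by have := dotZl a x y; rewrite (H y yA) mulr0.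
Qed.

Lemma dot_proj_ortho (A : 'M[C]_n) x y :
  (y <= A)%MS -> '[x *m proj_ortho A, y] = '[x, y].
Proof.
move=> yA; apply/esym/eqP; rewrite -subr_eq0 -linearBl.
by apply/eqP; move/sub_dot_orthoP: (proj_ortho_compl_sub A x); apply.
Qed.

Lemma dot_proj_orthoC (A : 'M[C]_n) x y :
  '[x *m proj_ortho A, y] = '[x, y *m proj_ortho A].
Proof.
rewrite -(dot_proj_ortho x (proj_ortho_sub _ _)) [LHS]dotC [RHS]dotC.
by rewrite dot_proj_ortho ?proj_ortho_sub.
Qed.

(** Let [z] be the projection of [v] onto [A].  Testing the bound on [z]
    normalised gives [|z| <= c]; since [<z, u> = c], the equality case of
    Cauchy-Schwarz forces [z = c *: u], in the form [|z - c u|^2 <= 0]. *)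
Lemma extremal_pair (A : 'M[C]_n) (c : C) u v :
  (u <= A)%MS -> '[u] = 1 -> '[u, v] = c -> 0 <= c ->
  (forall x, (x <= A)%MS -> '[x] = 1 -> `|'[x, v]| <= c) ->
  forall x, (x <= A)%MS -> '[x, v] = c * '[x, u].
Proof.
move=> uA u1 uv c0 H x xA; pose z := v *m proj_ortho A.
have zA : (z <= A)%MS by exact: proj_ortho_sub.
have dz y : (y <= A)%MS -> '[y, v] = '[y, z].
  by move=> yA; rewrite [RHS]dotC dot_proj_ortho // -dotC.
have uz : '[u, z] = c by rewrite -dz.
have zu : '[z, u] = c by rewrite dotC uz; apply/CrealP; rewrite ger0_real.
suff -> : '[x, v] = '[x, c *: u].
  by rewrite dotZr (CrealP (ger0_real c0)).
rewrite dz //; congr dotmx; apply/eqP; rewrite -subr_eq0 -sqnorm_eq0.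
have zc : '[z] <= c ^+ 2.
  have [->|z0] := eqVneq z 0; first by rewrite linear0l exprn_ge0.
  pose s := sqrtC '[z]; have zs : '[z] = s ^+ 2 by rewrite sqrtCK.
  have s0 : 0 < s by rewrite sqrtC_gt0 sqnorm_gt0.
  rewrite zs ler_pXn2r ?nnegrE ?(ltW s0) //.
  have := H (s^-1 *: z); rewrite dz ?scalemx_sub // sqnormZ dotZl zs normrM.
  rewrite normfV normrX (gtr0_norm s0) -exprMn mulVf ?gt_eqF // expr1n.
  by rewrite expr2 mulKf ?gt_eqF //; apply.
have c2 : Num.conj (c ^+ 2) = c ^+ 2 by apply/CrealP; rewrite realX ?ger0_real.
have zcu : '[z, c *: u] = c ^+ 2.
  by rewrite dotZr zu (CrealP (ger0_real c0)).
rewrite eq_le sqnorm_ge0 andbT sqnormB zcu c2 sqnormZ u1 mulr1 ger0_norm //.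
by rewrite addrKA subr_le0.
Qed.

(** The sum [s] of the projections satisfies [<x, s> = |s|^2], which is the
    left-hand side, and [|x - s|^2 >= 0]. *)
Lemma bessel (I : finType) (J : I -> 'M[C]_n) x :
  (forall i j y z, i != j -> (y <= J i)%MS -> (z <= J j)%MS -> '[y, z] = 0) ->
  \sum_i '[x *m proj_ortho (J i)] <= '[x].
Proof.
move=> oJ; pose s := \sum_i x *m proj_ortho (J i).
have xs : '[x, s] = \sum_i '[x *m proj_ortho (J i)].
  rewrite linear_sumr; apply: eq_bigr => i _ /=.
  by rewrite dot_proj_ortho ?proj_ortho_sub.
have ss : '[s] = \sum_i '[x *m proj_ortho (J i)].
  rewrite {1}/s linear_sumlz; apply: eq_bigr => i _ /=.
  rewrite linear_sumr (bigD1 i) //= big1 ?addr0 // => j ji.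
  by apply: (oJ i j); rewrite ?proj_ortho_sub // eq_sym.
have sr : Num.conj '[x, s] = '[x, s].
  by rewrite xs rmorph_sum; apply: eq_bigr => i _ /=; rewrite -dotC.
have := sqnorm_ge0 (x - s).
by rewrite sqnormB sr xs ss addrKA subr_ge0.
Qed.

End InnerProduct.

(** * Quadratic forms along a segment *)

Section QuadraticForm.
Context {C : numClosedFieldType} {n : nat}.
Implicit Types (A : {linear 'rV[C]_n -> 'rV[C]_n}) (x y z : 'rV[C]_n).

Lemma quad_expand A p q x y :
  '[A (p *: x + q *: y), p *: x + q *: y] =
  p * Num.conj p * '[A x, x] + q * Num.conj q * '[A y, y]
  + (p * Num.conj q * '[A x, y] + q * Num.conj p * '[A y, x]).
Proof.
have AE : A (p *: x + q *: y) = p *: A x + q *: A y by rewrite linearD !linearZ.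
rewrite AE !linearDl !linearDr /= !dotZl !dotZr.
move: (Num.conj p) (Num.conj q) => p' q'.
by ring.
Qed.

Lemma quad_ray A x : x != 0 ->
  exists l : C, '[l *: x] = 1 /\ '[A x, x] = '[x] * '[A (l *: x), l *: x].
Proof.
move=> x0; pose s := sqrtC '[x].
have s0 : 0 < s by rewrite sqrtC_gt0 sqnorm_gt0.
have xs : '[x] = s ^+ 2 by rewrite sqrtCK.
have sV : Num.conj s^-1 = s^-1 by apply/CrealP; rewrite ger0_real // invr_ge0 ltW.
exists s^-1; split.
  by rewrite sqnormZ xs normfV gtr0_norm // -exprMn mulVf ?gt_eqF ?expr1n.
have -> : A (s^-1 *: x) = s^-1 *: A x by rewrite linearZ.
rewrite dotZl dotZr sV xs.
by field; rewrite gt_eqF.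
Qed.

(** The function [l |-> l * e + conj l * f] differs from [l |-> l * d], where
    [d = e - conj f], by a real number; so [l = conj d] works, and
    any [l] does if [d = 0]. *)
Lemma rotate_real (e f : C) :
  exists l : C, l != 0 /\ l * e + Num.conj l * f \is Num.real.
Proof.
pose d := e - Num.conj f.
suff [l l0 ldr] : exists2 l, l != 0 & l * d \is Num.real.
  exists l; split=> //.
  have -> : l * e + Num.conj l * f =
     l * d + (l * Num.conj f + Num.conj (l * Num.conj f)).
    have -> : Num.conj (l * Num.conj f) = Num.conj l * f.
      by rewrite rmorphM /= conjCK.
    by rewrite /d mulrBr addrA subrK.
  by rewrite realD // CrealE rmorphD /= conjCK addrC.
have [d0|d0] := eqVneq d 0; first by exists 1; rewrite ?oner_eq0 // d0 mulr0 real0.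
by exists (Num.conj d); rewrite ?conjC_eq0 // mulrC -normCK rpredX // normr_real.
Qed.

(** The algebraic core of the convexity of the numerical range.  After the
    affine change of [A] that sends [a] to [0] and [b] to [1], multiplying [x] by a
    suitable [l] makes the cross terms real, so that along the segment from [l x]
    to [y] the form of [A] and the squared norm are both real quadratic
    polynomials in [s]. *)
Lemma quad_segment A x y (a := '[A x, x]) (b := '[A y, y]) :
  '[x] = 1 -> '[y] = 1 -> b != a ->
  exists l g h : C, [/\ l != 0, g \is Num.real, h \is Num.real &
    forall s, s \is Num.real -> exists z, [/\ (z <= x + y)%MS, z != 0,
      '[z] = `|l| ^+ 2 * (1 - s) ^+ 2 + s ^+ 2 + s * (1 - s) * h &
      '[A z, z] = a * '[z] + (b - a) * (s ^+ 2 + s * (1 - s) * g) ] ].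
Proof.
move=> x1 y1 ab; have ba : b - a != 0 by rewrite subr_eq0.
(* the cross terms of [(A - a) / (b - a)] *)
pose Bxy := ('[A x, y] - a * '[x, y]) / (b - a).
pose Byx := ('[A y, x] - a * '[y, x]) / (b - a).
have [l [l0 gr]] := rotate_real Bxy Byx.
exists l, (l * Bxy + Num.conj l * Byx), (l * '[x, y] + Num.conj l * '[y, x]).
split=> //; first by rewrite CrealE rmorphD !rmorphM /= conjCK -!dotC addrC.
move=> s sr; have sc : Num.conj s = s by apply/CrealP.
pose z := ((1 - s) * l) *: x + s *: y; exists z.
have pc : Num.conj ((1 - s) * l) = (1 - s) * Num.conj l.
  by rewrite rmorphM rmorphB rmorph1 /= sc.
have zz : '[z] = `|l| ^+ 2 * (1 - s) ^+ 2 + s ^+ 2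
    + s * (1 - s) * (l * '[x, y] + Num.conj l * '[y, x]).
  rewrite (quad_expand idfun) /= pc sc x1 y1 normCK.
  by move: (Num.conj l) => l'; ring.
split=> //.
- by rewrite addmx_sub_adds ?scalemx_sub.
- apply/eqP => z0; have [s0|s0] := eqVneq s 0.
    move: zz; rewrite z0 s0 dot0l subr0 !expr1n mulr1 expr0n /= !mul0r !addr0.
    by move/esym/eqP; rewrite expf_eq0 normr_eq0 (negbTE l0).
  (* if [z = 0] then [y] is a unimodular multiple of [x], so [b = a] *)
  pose m := - ((1 - s) * l) / s.
  have ym : y = m *: x.
    apply: (scalerI s0); rewrite scalerA mulrCA mulfV // mulr1 scaleNr.
    by apply/eqP; rewrite -addr_eq0 addrC -/z z0.
  have m1 : m * Num.conj m = 1 by rewrite -y1 ym sqnormZ x1 mulr1 normCK.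
  case/eqP: ab; rewrite /b ym.
  have -> : A (m *: x) = m *: A x by rewrite linearZ.
  by rewrite dotZl dotZr mulrA m1 mul1r.
- rewrite quad_expand pc sc -/a -/b zz normCK /Bxy /Byx.
  by move: (Num.conj l) => l'; field.
Qed.

End QuadraticForm.

(** * Convex sets of complex numbers *)

Section ConvexSets.
Context {R : realType}.
Implicit Types D : set R[i].

Lemma convex_set_complexP D :
  @convex_set R (Rcomplex R) D <->
  forall (t : R) (a b : R[i]), 0 <= t <= 1 -> D a -> D b ->
    D (t%:C * a + (1 - t)%:C * b).
Proof.
have convE (l : {i01 R}) (a b : R[i]) :
    conv l (a : convex_lmodType (Rcomplex R)) b
    = l%:num%:C * a + (1 - l%:num)%:C * b.
  case: a => a1 a2; case: b => b1 b2; apply/eqP.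
  by rewrite eq_complex /= !mul0r !addr0 !subr0 !eqxx.
split=> [cD t a b t01 Da Db|cD a b l /set_mem Da /set_mem Db].
  by have := cD a b (Itv01 (andP t01).1 (andP t01).2); rewrite convE !inE; apply.
by apply/mem_set; rewrite convE; apply: cD => //; apply/andP; split.
Qed.

(** The partial sums are kept in the form [T * d] with [d] in [D] and [T] the
    sum of the weights, so that adding two of them is one binary convex
    combination.  In the end [0] takes the weight [1 - T]. *)
Lemma convex_sum_sub1 D (I : finType) (z T : I -> R[i]) :
  @convex_set R (Rcomplex R) D -> D 0 ->
  (forall i, 0 <= T i) ->
  (forall i, exists2 d, D d & z i = T i * d) ->
  \sum_i T i <= 1 -> D (\sum_i z i).
Proof.
move=> /convex_set_complexP cD D0 T0 zT.
pose K (z T : R[i]) := 0 <= T /\ exists2 d, D d & z = T * d.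
have [S0 [d Dd ->]] : K (\sum_i z i) (\sum_i T i).
  apply: (big_ind2 K) => [|z1 T1 z2 T2 [T10 [d1 Dd1 ->]] [T20 [d2 Dd2 ->]]|i _].
  - split=> //; exists 0 => //; exact/esym/mulr0.
  - split; first exact: addr_ge0.
    have [TT|TT] := eqVneq (T1 + T2) 0.
      move: (TT) => /eqP; rewrite paddr_eq0 // => /andP[/eqP-> /eqP->].
      by exists 0 => //; rewrite !(mul0r, mulr0) addr0.
    have /complex_realP[t tE] : T1 / (T1 + T2) \is Num.real.
      by rewrite ger0_real // divr_ge0 ?addr_ge0.
    exists (t%:C * d1 + (1 - t)%:C * d2).
      apply: cD => //; rewrite -ler0c -lecR -tE divr_ge0 ?addr_ge0 //=.
      by rewrite ler_pdivrMr ?mul1r ?lerDl // lt0r TT addr_ge0.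
    have -> : (1 - t)%:C = 1 - T1 / (T1 + T2) by rewrite tE rmorphB.
    by rewrite -tE; field.
  - by split.
move=> S1; have /complex_realP[t tE] : \sum_i T i \is Num.real by rewrite ger0_real.
rewrite -[_ * d]addr0 -[X in _ + X](mulr0 (1 - t)%:C) tE; apply: cD => //.
by rewrite -ler0c -lecR -tE S0 S1.
Qed.

Lemma between0_scale (z T : R[i]) : 0 <= z <= T ->
  exists2 r : R, 0 <= r <= 1 & z = T * r%:C.
Proof.
move=> /andP[z0 zT]; have T0 := le_trans z0 zT.
have [T_0|T_n0] := eqVneq T 0.
  exists 0; first by rewrite lexx ler01.
  by apply/eqP; rewrite T_0 mul0r eq_le z0 andbT -T_0.
have q0 : 0 <= z / T by exact: divr_ge0.
have /complex_realP[r rE] := ger0_real q0.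
exists r; last by rewrite -rE mulrC divfK.
by rewrite -ler0c -lecR -rE q0 /= ler_pdivrMr ?mul1r // lt0r T_n0.
Qed.

End ConvexSets.

(** * Convexity of the numerical range *)

Section NumericalRange.
Context {R : realType} {n : nat}.
Local Notation C := R[i].
Local Notation V := 'rV[C]_n.
Implicit Types (A : {linear V -> V}) (H : 'M[C]_n) (x y : V).

Lemma vnorm1 x : vnorm x = 1 <-> '[x] = 1.
Proof.
rewrite /vnorm; split=> [x1|->]; last exact: sqrtC1.
by rewrite -['[x]]sqrtCK x1 expr1n.
Qed.

Lemma num_rangeP A H a :
  num_range A H a <-> exists x, [/\ (x <= H)%MS, '[x] = 1 & '[A x, x] = a].
Proof.
split=> [[x [xH /vnorm1 x1] <-]|[x [xH x1 <-]]]; first by exists x.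
by exists x => //; split=> //; apply/vnorm1.
Qed.

Lemma num_range_ray A H x : (x <= H)%MS -> x != 0 ->
  exists2 d, num_range A H d & '[A x, x] = '[x] * d.
Proof.
move=> xH /(quad_ray A)[l [l1 lE]]; exists '[A (l *: x), l *: x] => //.
by apply/num_rangeP; exists (l *: x); split=> //; exact: scalemx_sub.
Qed.

Lemma num_range_quotient A H x a : (x <= H)%MS -> x != 0 ->
  '[A x, x] = a * '[x] -> num_range A H a.
Proof.
move=> xH x0 xE; have [d dW dE] := num_range_ray A xH x0.
suff -> : a = d by [].
by apply: (mulIf (x := '[x])); rewrite ?sqnorm_eq0 // -xE dE mulrC.
Qed.

(** Along the segment of [quad_segment], the equation saying that the
    normalised form takes the intermediate value at [t] is polynomial in [s] and
    changes sign between [0] and [1]; the intermediate value theorem for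
    polynomials gives a solution. *)
Lemma toeplitz_hausdorff A H : @convex_set R (Rcomplex R) (num_range A H).
Proof.
apply/convex_set_complexP => t _ _ t01 /num_rangeP[y [yH y1 <-]] /num_rangeP[x [xH x1 <-]].
have -> : (1 - t)%:C = 1 - t%:C by rewrite rmorphB.
have [ab|ab] := eqVneq '[A y, y] '[A x, x].
  apply/num_rangeP; exists x; split=> //; rewrite ab.
  by move: (t%:C) '[A x, x] => s a; ring.
have [l [g0 [h0 [l0 /complex_realP[g gE] /complex_realP[h hE] seg]]]] :=
  quad_segment x1 y1 ab.
have /complex_realP[k kE] : `|l| ^+ 2 \is Num.real by rewrite rpredX // normr_real.
have k0 : 0 < k by rewrite -ltcR -kE exprn_gt0 // normr_gt0.
(* [p] vanishes at [s] iff the rescaled form at [z] equals [t * |z|^2] *)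
pose p : {poly R} := 'X ^+ 2 + ('X * (1 - 'X)) * g%:P
  - t%:P * (k%:P * (1 - 'X) ^+ 2 + 'X ^+ 2 + ('X * (1 - 'X)) * h%:P).
have pE s : p.[s] = s ^+ 2 + s * (1 - s) * g
   - t * (k * (1 - s) ^+ 2 + s ^+ 2 + s * (1 - s) * h).
  by rewrite /p !(hornerE, hornerXn).
have [s _ /rootP] : exists2 s, 0 <= s <= 1 & root p s.
  apply: poly_ivt => //; rewrite !pE; case/andP: t01 => ? ?.
  by apply/andP; split; nra.
rewrite pE => /subr0_eq ps.
have /seg[z [zxy z0 zz Az]] : s%:C \is Num.real by apply/complex_realP; exists s.
have zH : (z <= H)%MS by rewrite (submx_trans zxy) // addsmx_sub xH.
have [e eW eE] := num_range_ray A zH z0.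
suff <- : e = t%:C * '[A y, y] + (1 - t%:C) * '[A x, x] by [].
have sE : (s%:C ^+ 2 + s%:C * (1 - s%:C) * g0) = t%:C * '[z].
  rewrite zz gE hE kE -(rmorph1 (real_complex R)) -!(rmorphB, rmorphXn, rmorphM, rmorphD).
  by rewrite ps.
apply: (mulfI (x := '[z])); first by rewrite sqnorm_eq0.
rewrite -eE Az sE.
by move: '[A y, y] '[A x, x] '[z] (t%:C) => b a N t'; ring.
Qed.

End NumericalRange.

(** * Biorthogonal systems and the product of two projections *)

Section BiorthogonalSystem.
Context {C : numClosedFieldType} {n q : nat}.
Implicit Types x y a b : 'rV[C]_n.

Lemma sub_ortho_sumsP (P : pred 'I_q) (w : 'I_q -> 'rV[C]_n) x :
  reflect (forall j, P j -> '[x, w j] = 0)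
    (x <= orthomx Num.conj 1%:M (\sum_(j | P j) <<w j>>)%MS)%MS.
Proof.
apply: (iffP idP) => [/sub_dot_orthoP xw j Pj|xw].
  by apply: xw; rewrite (sumsmx_sup j) ?genmxE.
rewrite (orthomx_sym (hermitian1mx _)); apply/sumsmx_subP => j Pj.
rewrite genmxE (orthomx_sym (hermitian1mx _)).
by apply/(hermmx_eq0P (hermitian1mx _))/xw.
Qed.

(** The matrix [W] with rows [w i] is unitary, so it has rank [q]; lying in [M],
    it has the row space of [M].  The difference [d] of the two sides is then both
    in the span of the [w i] and orthogonal to it. *)
Lemma orthonormal_spans (M : 'M[C]_n) (w : 'I_q -> 'rV[C]_n) a :
  (forall i, (w i <= M)%MS) -> (forall i j, '[w i, w j] = (i == j)%:R) ->
  (\rank M <= q)%N -> (a <= M)%MS -> a = \sum_i '[a, w i] *: w i.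
Proof.
move=> wM ow rM aM; pose W : 'M[C]_(q, n) := \matrix_i w i.
have WM : (W <= M)%MS by apply/row_subP => i; rewrite rowK.
have Wu : W \is unitarymx by apply/row_unitarymxP => i j; rewrite !rowK ow.
have MW : (M <= W)%MS.
  by rewrite -(mxrank_leqif_sup WM) eqn_leq mxrankS //= (mxrank_unitary Wu).
pose d := a - \sum_i '[a, w i] *: w i.
have dM : (d <= M)%MS.
  by rewrite addmx_sub ?eqmx_opp // summx_sub // => i _; rewrite scalemx_sub.
have dw : (d <= orthomx Num.conj 1%:M (\sum_i <<w i>>)%MS)%MS.
  apply/sub_ortho_sumsP => j _; rewrite linearBl linear_sumlz /= (bigD1 j) //=.
  rewrite big1 => [|i ij]; rewrite dotZl ow ?(negbTE ij) ?mulr0 //.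
  by rewrite eqxx mulr1 addr0 subrr.
apply/eqP; rewrite -subr_eq0 -/d -sqnorm_eq0; apply/eqP.
move/sub_dot_orthoP: dw; apply; apply: submx_trans dM (submx_trans MW _).
by apply/row_subP => i; rewrite rowK (sumsmx_sup i) ?genmxE.
Qed.

(** The situation of principal vectors, reduced to what the decomposition of the
    quadratic form needs: [dot_v] says that the projection of [v i] onto [M] is
    [c i *: u i], and [dot_u] that the projection of [u i] onto [N] is
    [c i *: v i]. *)
Context {M N : 'M[C]_n} {c : 'I_q -> C} {u v : 'I_q -> 'rV[C]_n}.
Context (uM : forall i, (u i <= M)%MS).
Context (vN : forall i, (v i <= N)%MS).
Context (u_on : forall i j, '[u i, u j] = (i == j)%:R).
Context (v_on : forall i j, '[v i, v j] = (i == j)%:R).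
Context (c_real : forall i, Num.conj (c i) = c i).
Context (dot_v : forall a i, (a <= M)%MS -> '[a, v i] = c i * '[a, u i]).
Context (dot_u : forall b i, (b <= N)%MS -> '[b, u i] = c i * '[b, v i]).
Context (q_min : q = minn (\rank M) (\rank N)).

(** The smaller of [M] and [N] is spanned by its own family.  Expanding the
    vector of that subspace suffices, since the coefficients of the other vector
    follow from [dot_v] or [dot_u]. *)
Lemma dot_principal a b : (a <= M)%MS -> (b <= N)%MS ->
  '[b, a] = \sum_i c i * '[b, v i] * Num.conj '[a, u i].
Proof.
move=> aM bN; have [MN|NM] := leqP (\rank M) (\rank N).
  have rM : (\rank M <= q)%N by rewrite q_min (minn_idPl MN).
  rewrite {1}(orthonormal_spans uM u_on rM aM) linear_sumr.
  by apply: eq_bigr => i _; rewrite /= dotZr (dot_u i bN) mulrC.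
have rN : (\rank N <= q)%N by rewrite q_min (minn_idPr (ltnW NM)).
rewrite {1}(orthonormal_spans vN v_on rN bN) linear_sumlz.
apply: eq_bigr => i _; rewrite /= dotZl (dotC (v i)) (dot_v i aM) rmorphM /= c_real.
by rewrite mulrCA mulrA.
Qed.

Local Notation PQ x := (x *m proj_ortho N *m proj_ortho M).

Lemma dot_projs x :
  '[PQ x, x] = \sum_i c i * '[x, v i] * Num.conj '[x, u i].
Proof.
rewrite dot_proj_orthoC dot_principal ?proj_ortho_sub //.
by apply: eq_bigr => i _; rewrite !dot_proj_ortho.
Qed.

Let J i : 'M[C]_n := (<<u i>> + <<v i>>)%MS.

Let uJ i : (u i <= J i)%MS.
Proof. by rewrite (submx_trans _ (addsmxSl _ _)) ?genmxE. Qed.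

Let vJ i : (v i <= J i)%MS.
Proof. by rewrite (submx_trans _ (addsmxSr _ _)) ?genmxE. Qed.

Lemma jordan_orthogonal i j y z :
  i != j -> (y <= J i)%MS -> (z <= J j)%MS -> '[y, z] = 0.
Proof.
move=> ij /sub_addsmxP[[s1 s2] /= ->] /sub_addsmxP[[s3 s4] /= ->].
have sub1 s (w : 'rV[C]_n) : exists k, s *m <<w>>%MS = k *: w :> 'rV[C]_n.
  by apply/sub_rVP; rewrite (submx_trans (submxMl _ _)) ?genmxE.
have [k1 ->] := sub1 s1 (u i); have [k2 ->] := sub1 s2 (v i).
have [k3 ->] := sub1 s3 (u j); have [k4 ->] := sub1 s4 (v j).
rewrite linearDl !linearDr /= !dotZl !dotZr !u_on !v_on.
by rewrite (dot_v j (uM i)) (dot_u j (vN i)) u_on v_on (negbTE ij) !mulr0 !addr0.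
Qed.

Let xJ x i := x *m proj_ortho (J i).

Lemma dot_projs_plane x i :
  '[PQ (xJ x i), xJ x i] = c i * '[xJ x i, v i] * Num.conj '[xJ x i, u i].
Proof.
rewrite dot_projs (bigD1 i) //= big1 ?addr0 // => j ji.
rewrite (@jordan_orthogonal i j _ (v j)) ?vJ ?proj_ortho_sub //.
  by rewrite mulr0 mul0r.
by rewrite eq_sym.
Qed.

Lemma dot_projs_sum x :
  '[PQ x, x] = \sum_i '[PQ (xJ x i), xJ x i].
Proof.
rewrite dot_projs; apply: eq_bigr => i _.
by rewrite dot_projs_plane !dot_proj_ortho.
Qed.

(** When [c i = 1] the vectors [u i] and [v i] coincide, and the form is the
    squared modulus of one coefficient, bounded by Cauchy-Schwarz. *)
Lemma dot_projs_angle0 x i : c i = 1 ->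
  0 <= '[PQ (xJ x i), xJ x i] <= '[xJ x i].
Proof.
move=> ci; rewrite dot_projs_plane ci mul1r.
have u1 : '[u i] = 1 by rewrite u_on eqxx.
have v1 : '[v i] = 1 by rewrite v_on eqxx.
have uv : '[u i, v i] = 1 by rewrite (dot_v i (uM i)) ci u1 mulr1.
have -> : v i = u i.
  apply/esym/eqP; rewrite -subr_eq0 -sqnorm_eq0 sqnormB uv u1 v1.
  by rewrite rmorph1 subrr.
rewrite -normCK exprn_ge0 //=.
have [+ _] := CauchySchwarz (@dotmx C n) (xJ x i) (u i).
by move/le_trans; apply; rewrite /= u1 mulr1.
Qed.

End BiorthogonalSystem.

(** * Principal vectors are biorthogonal *)

Section PrincipalVectors.
Context {R : realType} {n : nat} {M N : 'M[R[i]]_n}.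
Context {theta : 'I_(nb_angles M N) -> R} {u v : 'I_(nb_angles M N) -> 'rV[R[i]]_n}.
Context (huv : principal_system theta u v).
Local Notation q := (nb_angles M N).
Implicit Types (x y : 'rV[R[i]]_n) (i j : 'I_q).

Let c i : R[i] := (cos (theta i))%:C.

Lemma sub_restP (A : 'M[R[i]]_n) (w : 'I_q -> 'rV[R[i]]_n) i x :
  reflect ((x <= A)%MS /\ forall j, (j < i)%N -> '[x, w j] = 0)
    (x <= rest w A i)%MS.
Proof.
by rewrite /rest sub_capmx; apply: (iffP andP) => -[xA /sub_ortho_sumsP xw].
Qed.

Lemma principal_uM i : (u i <= M)%MS.
Proof. by have [/sub_restP[]] := principal_vectl huv i. Qed.

Lemma principal_vN i : (v i <= N)%MS.
Proof. by have [/sub_restP[]] := principal_vectr huv i. Qed.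

Lemma orthonormal_rest (A : 'M[R[i]]_n) (w : 'I_q -> 'rV[R[i]]_n) :
  (forall i, (w i <= rest w A i)%MS /\ vnorm (w i) = 1) ->
  forall i j, '[w i, w j] = (i == j)%:R.
Proof.
move=> wA i j; case: (ltngtP i j) => [ij|ij|/val_inj <-]; last first.
- by rewrite eqxx; have [_ /vnorm1] := wA i.
- rewrite -val_eqE /= gtn_eqF //; have [/sub_restP[_ wi] _] := wA i; exact: wi.
- rewrite -val_eqE /= ltn_eqF //; have [/sub_restP[_ wj] _] := wA j.
  by rewrite dotC wj ?rmorph0.
Qed.

Lemma principal_uu i j : '[u i, u j] = (i == j)%:R.
Proof. exact: orthonormal_rest (principal_vectl huv) i j. Qed.

Lemma principal_vv i j : '[v i, v j] = (i == j)%:R.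
Proof. exact: orthonormal_rest (principal_vectr huv) i j. Qed.

Lemma principal_cosC i : Num.conj (c i) = c i.
Proof. by apply/CrealP/complex_realP; exists (cos (theta i)). Qed.

Lemma principal_cos_ge0 i : 0 <= c i.
Proof.
rewrite ler0c; have /andP[t0 tpi] := principal_angle_itv huv i.
by apply: cos_ge0_pihalf; rewrite tpi andbT (le_trans _ t0) // oppr_le0 divr_ge0 ?pi_ge0.
Qed.

Lemma cauchy_schwarz_unit x y : '[x] = 1 -> '[y] = 1 -> `|'[x, y]| <= 1.
Proof.
move=> x1 y1; have [+ _] := CauchySchwarz (@dotmx R[i] n) x y.
by rewrite /= x1 y1 mulr1 -[leRHS](expr1n _ 2) ler_pXn2r ?nnegrE.
Qed.

(** The set whose supremum defines the cosine is bounded by Cauchy-Schwarz;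
    without that bound its [sup] would say nothing. *)
Lemma principal_extremal i x y :
  (x <= rest u M i)%MS -> (y <= rest v N i)%MS -> '[x] = 1 -> '[y] = 1 ->
  `|'[x, y]| <= c i.
Proof.
move=> xM yN x1 y1.
have /complex_realP[r rE] : `|'[x, y]| \is Num.real by exact: normr_real.
rewrite rE lecR (principal_cos_sup huv); apply: ub_le_sup.
  exists 1 => s [x' [y' [_ _ /vnorm1 x'1 /vnorm1 y'1 sE]]].
  by rewrite -lecR sE cauchy_schwarz_unit.
by exists x, y; split=> //; apply/vnorm1.
Qed.

Lemma principal_rest_dot_v i x : (x <= rest u M i)%MS -> '[x, v i] = c i * '[x, u i].
Proof.
have [uR /vnorm1 u1] := principal_vectl huv i.
have [vR /vnorm1 v1] := principal_vectr huv i.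
have uv : '[u i, v i] = c i by rewrite -(principal_cos_dot huv).
apply: (extremal_pair uR u1 uv (principal_cos_ge0 i)) => y yM y1.
exact: principal_extremal.
Qed.

Lemma principal_rest_dot_u i y : (y <= rest v N i)%MS -> '[y, u i] = c i * '[y, v i].
Proof.
have [uR /vnorm1 u1] := principal_vectl huv i.
have [vR /vnorm1 v1] := principal_vectr huv i.
have vu : '[v i, u i] = c i.
  by rewrite dotC -(principal_cos_dot huv) -/(c i) principal_cosC.
apply: (extremal_pair vR v1 vu (principal_cos_ge0 i)) => x xN x1.
by rewrite dotC norm_conjC; exact: principal_extremal.
Qed.

(** Subtracting from [x] its projection onto the span of the first [i] vectors
    does not change the products with vectors orthogonal to that span.  This is
    how relations on the remaining part extend to the whole subspace. *)
Lemma principal_rest_decomp (A : 'M[R[i]]_n) (w : 'I_q -> 'rV[R[i]]_n) i x :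
  (forall j, (w j <= A)%MS) -> (x <= A)%MS ->
  exists2 y, (y <= rest w A i)%MS &
    forall z, (forall j, (j < i)%N -> '[z, w j] = 0) -> '[x, z] = '[y, z].
Proof.
move=> wA xA; exists (x - x *m proj_ortho (span_before w i)).
  rewrite sub_capmx proj_ortho_compl_sub andbT addmx_sub // eqmx_opp.
  apply: (submx_trans (proj_ortho_sub _ _)); apply/sumsmx_subP => j _.
  by rewrite genmxE.
move=> z zw; rewrite linearBl /= [X in _ - X]dotC.
suff -> : '[z, x *m proj_ortho (span_before w i)] = 0 by rewrite rmorph0 subr0.
have /sub_ortho_sumsP/sub_dot_orthoP : forall j, (j < i)%N -> '[z, w j] = 0 by [].
by apply; exact: proj_ortho_sub.
Qed.

(** For [j < i] the vector [v i] still belongs to the j-th remaining part of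
    [N], so [<v i, u j> = c j * <v i, v j> = 0].  Thus [u i] and [v i] are both
    orthogonal to the first [i] vectors [u j], and the relation on the remaining
    part extends to [M]. *)
Lemma principal_dot_v x i : (x <= M)%MS -> '[x, v i] = c i * '[x, u i].
Proof.
move=> xM; have [y yR yE] := principal_rest_decomp i principal_uM xM.
have [/sub_restP[_ ui] _] := principal_vectl huv i.
have [/sub_restP[vN vi] _] := principal_vectr huv i.
rewrite (yE (u i) ui) (yE (v i)); first exact: principal_rest_dot_v.
move=> j ji; rewrite principal_rest_dot_u; first by rewrite vi ?mulr0.
by apply/sub_restP; split=> // k kj; apply: vi; exact: ltn_trans ji.
Qed.

Lemma principal_dot_u x i : (x <= N)%MS -> '[x, u i] = c i * '[x, v i].
Proof.
move=> xN; have [y yR yE] := principal_rest_decomp i principal_vN xN.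
have [/sub_restP[_ vi] _] := principal_vectr huv i.
have [/sub_restP[uM ui] _] := principal_vectl huv i.
rewrite (yE (v i) vi) (yE (u i)); first exact: principal_rest_dot_u.
move=> j ji; rewrite principal_rest_dot_v; first by rewrite ui ?mulr0.
by apply/sub_restP; split=> // k kj; apply: ui; exact: ltn_trans ji.
Qed.

End PrincipalVectors.

(** * The numerical range of a product of two projections *)

Section NumericalRangeOfProduct.
Context {R : realType} {n : nat}.
Implicit Types (M N : 'M[R[i]]_n) (x : 'rV[R[i]]_n).

Lemma exists_ortho_row M : ~~ row_full M ->
  exists2 x : 'rV[R[i]]_n, x != 0 & x *m proj_ortho M = 0.
Proof.
move=> fM; suff /rowV0Pn[x xM x0] : orthocomp M != 0.
  by exists x => //; exact: proj_ortho_0.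
have rM : \rank (orthocomp M) = (n - \rank M)%N := rank_ortho M.
by rewrite -mxrank_eq0 rM subn_eq0 -ltnNge ltn_neqAle rank_leq_col andbT.
Qed.

(** For [x] orthogonal to [N], [Qx = 0]; for [x] orthogonal to [M],
    [<PQx, x> = <Qx, Px> = 0]. *)
Lemma num_range0 M N : ~ (row_full M /\ row_full N) ->
  num_range (orthoproj M \o orthoproj N) 1%:M 0.
Proof.
move=> fMN; suff [x x0 xE] : exists2 x : 'rV[R[i]]_n,
    x != 0 & '[x *m proj_ortho N *m proj_ortho M, x] = 0.
  apply: (num_range_quotient (submx1 x) x0); rewrite mul0r; exact: xE.
have [fM|/exists_ortho_row[x x0 xM]] := boolP (row_full M); last first.
  by exists x; [exact: x0|rewrite dot_proj_orthoC xM dot0r].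
have /exists_ortho_row[x x0 xN] : ~~ row_full N by apply/negP => fN; apply: fMN.
by exists x => //; rewrite xN mul0mx dot0l.
Qed.

Lemma num_range1 M N : (M :&: N)%MS != 0 ->
  num_range (orthoproj M \o orthoproj N) 1%:M 1.
Proof.
case/rowV0Pn=> x; rewrite sub_capmx => /andP[xM xN] x0.
have xE : '[x *m proj_ortho N *m proj_ortho M, x] = '[x].
  by rewrite !proj_ortho_id.
apply: (num_range_quotient (submx1 x) x0); rewrite mul1r; exact: xE.
Qed.

Lemma unit_segment_sub M N :
  (M :&: N)%MS != 0 -> ~ (row_full M /\ row_full N) ->
  unit_segment `<=` num_range (orthoproj M \o orthoproj N) 1%:M.
Proof.
move=> MN fMN _ [t t01 <-]; rewrite -[t%:C]mulr1 -[_ * 1]addr0 -(mulr0 (1 - t)%:C).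
move/convex_set_complexP: (@toeplitz_hausdorff R n (orthoproj M \o orthoproj N) 1%:M).
by apply; [exact: t01|exact: num_range1|exact: num_range0].
Qed.

End NumericalRangeOfProduct.

Theorem corollary4 (R : realType) (n : nat) (M N : 'M[R[i]]_n)
    (theta : 'I_(nb_angles M N) -> R)
    (u v : 'I_(nb_angles M N) -> 'rV[R[i]]_n)
    (huv : principal_system theta u v)
    (hMN : (M :&: N)%MS != 0)
    (hproper : ~ (row_full M /\ row_full N)) :
  num_range (orthoproj M \o orthoproj N) 1%:M =
  conv_hull (unit_segment `|`
    \bigcup_(k in [set k | 0 < theta k < pi / 2])
      num_range (orthoproj M \o orthoproj N) (jordan_plane u v k)).
Proof.
have [uM vN] := (principal_uM huv, principal_vN huv).
have [uu vv] := (principal_uu huv, principal_vv huv).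
have [dv du] := (principal_dot_v huv, principal_dot_u huv).
have cC := @principal_cosC _ _ _ _ theta.
(* the hull lies in [W(PQ)], which is convex and contains its generators *)
apply/seteqP; split; last first.
  apply: smallest_sub; first exact: toeplitz_hausdorff.
  rewrite subUset; split; first exact: unit_segment_sub.
  move=> a [k _ /num_rangeP[x [_ x1 xE]]].
  by apply/num_rangeP; exists x; split=> //; exact: submx1.
move=> _ /num_rangeP[x [_ x1 <-]] D [cD ED].
have D01 t : 0 <= t <= 1 -> D t%:C by move=> t01; apply: ED; left; exists t.
have D0 : D 0 by apply: (D01 0); rewrite lexx ler01.
pose xJ i := x *m proj_ortho (<<u i>> + <<v i>>)%MS.
pose z i := '[xJ i *m proj_ortho N *m proj_ortho M, xJ i].
have PQx : '[(orthoproj M \o orthoproj N) x, x] = \sum_i z i.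
  exact: (dot_projs_sum uM vN uu vv cC dv du erefl x).
rewrite PQx; apply: (@convex_sum_sub1 R D _ z (fun i => '[xJ i])) => //.
- by move=> i; exact: sqnorm_ge0.
- move=> i; have [xi0|xi0] := eqVneq (xJ i) 0.
    by exists 0 => //; rewrite mulr0 /z xi0 dot0r.
  have /andP[t0 tpi] := principal_angle_itv huv i.
  have [t_0|t_n0] := eqVneq (theta i) 0.
    have c1 : (cos (theta i))%:C = 1 by rewrite t_0 cos0.
    have zi : 0 <= z i <= '[xJ i].
      exact: (dot_projs_angle0 uM vN uu vv cC dv du erefl x c1).
    have [r r01 rE] := between0_scale zi.
    by exists r%:C; [exact: D01|exact: rE].
  have [t_pi|t_npi] := eqVneq (theta i) (pi / 2).
    have c0 : (cos (theta i))%:C = 0 by rewrite t_pi cos_pihalf.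
    exists 0 => //; rewrite mulr0 /z (dot_projs_plane uM vN uu vv cC dv du erefl).
    by rewrite c0 !mul0r.
  have [d dW dE] := num_range_ray (orthoproj M \o orthoproj N)
    (proj_ortho_sub (jordan_plane u v i) x) xi0.
  exists d; last exact: dE.
  apply: ED; right; exists i => //=.
  by rewrite !lt_neqAle t0 tpi t_npi eq_sym t_n0.
- rewrite -x1; apply: bessel => i j y w.
  exact: (jordan_orthogonal uM vN uu vv dv du).
Qed.
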